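(* Let $A$ be a $k$-algebra and let $s\colon C\otimes A\to A\otimes C$ be a twisting map. For $a\in A$ let $M(a)\in M_n(A)$ be the matrix with entries $M(a)_{ij}:=\gamma^i_j(a)$ for $0\le i,j<n$. Then the formulas $\varphi(a):=M(a)$ for $a\in A$ and $\varphi(y):=J_0$, where $J_0\in M_n(A)$ is the nilpotent Jordan matrix with $1$ in the entries $(i,i+1)$ ($0\le i<n-1$) and $0$ elsewhere, define a faithful representation (that is, an injective $k$-algebra homomorphism) $\varphi\colon A\otimes_s C\to M_n(A)$.
   Context: $k$ is a commutative ring; all algebras are associative unital $k$-algebras, all maps are $k$-linear and $\otimes$ means $\otimes_k$. $n\ge 1$ is an integer and $C:=k[y]/\langle y^n\rangle$. A twisting map is a $k$-linear map $s\colon C\otimes A\to A\otimes C$ such that (1) $s(1\otimes a)=a\otimes 1$ and $s(c\otimes 1)=1\otimes c$; (2) $s\circ(\mu_C\otimes A)=(A\otimes\mu_C)\circ(s\otimes C)\circ(C\otimes s)$; (3) $s\circ(C\otimes\mu_A)=(\mu_A\otimes C)\circ(A\otimes s)\circ(s\otimes A)$, where $\mu_A,\mu_C$ are the multiplication maps and an algebra symbol also denotes its identity map. $A\otimes_s C$ is the $k$-module $A\otimes C$ with unit $1\otimes 1$ and multiplication $(\mu_A\otimes\mu_C)\circ(A\otimes s\otimes C)$; it is an associative algebra containing $A$ (via $a\mapsto a\otimes 1$) and $C$ (via $c\mapsto 1\otimes c$) as subalgebras, and $a$, $y$ denote the images of $a\in A$ and $y\in C$. The maps $\gamma^r_j\colon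 A\to A$ are defined by $s(y^r\otimes a)=\sum_{j=0}^{n-1}\gamma^r_j(a)\otimes y^j$ for $0\le j,r<n$. *)

(* Defs.v *)
From HB Require Import structures.
From mathcomp Require Import all_boot all_algebra.
From mathcomp Require Import generic_quotient ring_quotient.
From mathcomp Require Import boolp.
From mathcomp Require Import freeg.

Set Implicit Arguments.
Unset Strict Implicit.
Unset Printing Implicit Defensive.

Import GRing.Theory.
Local Open Scope ring_scope.
Local Open Scope quotient_scope.

Reserved Notation "u ⊗ v" (at level 39, left associativity).

Section TensorProduct.
Variables (k : comNzRingType) (U V : lmodType k).

(* [U ⊗ V] is the free module on [U * V] modulo the submodule spanned by the  *)
(* bilinearity relations.                                                     *)
Definition tens_free := {freeg (U * V) / k}.
HB.instance Definition _ := GRing.Lmodule.on tens_free.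

Definition tens_gen (u : U) (v : V) : tens_free := << (u, v) >>.

Inductive tens_null : tens_free -> Prop :=
| TensNullDl u u' v :
    tens_null (tens_gen (u + u') v - tens_gen u v - tens_gen u' v)
| TensNullDr u v v' :
    tens_null (tens_gen u (v + v') - tens_gen u v - tens_gen u v')
| TensNullZl c u v : tens_null (tens_gen (c *: u) v - c *: tens_gen u v)
| TensNullZr c u v : tens_null (tens_gen u (c *: v) - c *: tens_gen u v)
| TensNull0 : tens_null 0
| TensNullP c x y : tens_null x -> tens_null y -> tens_null (c *: x + y).

Definition tens_nullb : {pred tens_free} := fun x => `[< tens_null x >].

Lemma tens_nullb_submod_closed : submod_closed tens_nullb.
Proof.
split=> [|c x y /asboolP nx /asboolP ny]; first exact/asboolP/TensNull0.
exact/asboolP/TensNullP.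
Qed.

HB.instance Definition _ := GRing.isZmodClosed.Build tens_free tens_nullb
  (GRing.submod_closedB tens_nullb_submod_closed).

Definition tens := Quotient.quot tens_nullb.
HB.instance Definition _ := GRing.Zmodule.on tens.
HB.instance Definition _ := EqQuotient.on tens.

Lemma tens_piP (x y : tens_free) :
  reflect (\pi_tens x = \pi_tens y) (x - y \in tens_nullb).
Proof. by rewrite Quotient.idealrBE; apply: eqP. Qed.

Lemma tens_piD (x y : tens_free) : \pi_tens (x + y) = \pi_tens x + \pi_tens y.
Proof. exact: Quotient.pi_add. Qed.

Definition tens_scale (c : k) (t : tens) : tens := \pi_tens (c *: repr t).

Lemma tens_pi_scale c (x : tens_free) :
  tens_scale c (\pi_tens x) = \pi_tens (c *: x).
Proof.
apply/tens_piP; rewrite -scalerBr -[_ *: _]addr0.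
have [n0 nP] := tens_nullb_submod_closed; apply: nP => //.
by apply/tens_piP; rewrite reprK.
Qed.

Fact tens_scaleA a b t : tens_scale a (tens_scale b t) = tens_scale (a * b) t.
Proof.
by rewrite -[t]reprK (tens_pi_scale b) (tens_pi_scale a) tens_pi_scale scalerA.
Qed.
Fact tens_scale1 : left_id 1 tens_scale.
Proof. by move=> t; rewrite -[t]reprK !tens_pi_scale scale1r. Qed.
Fact tens_scaleDr : right_distributive tens_scale +%R.
Proof.
move=> c t t'; rewrite -[t]reprK -[t']reprK -tens_piD !tens_pi_scale.
by rewrite scalerDr tens_piD.
Qed.
Fact tens_scaleDl t : {morph tens_scale^~ t : a b / a + b}.
Proof.
by move=> a b; rewrite /= -[t]reprK !tens_pi_scale scalerDl tens_piD.
Qed.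

HB.instance Definition _ := GRing.Zmodule_isLmodule.Build k tens
  tens_scaleA tens_scale1 tens_scaleDr tens_scaleDl.

Lemma tens_piZ c (x : tens_free) : \pi_tens (c *: x) = c *: \pi_tens x.
Proof. by rewrite [RHS]tens_pi_scale. Qed.

Definition ptens (u : U) (v : V) : tens := \pi_tens (tens_gen u v).

Local Notation "u ⊗ v" := (ptens u v).

Lemma ptensDl u u' v : (u + u') ⊗ v = u ⊗ v + u' ⊗ v.
Proof.
rewrite /ptens -tens_piD; apply/tens_piP/asboolP; rewrite opprD addrA.
exact: TensNullDl.
Qed.
Lemma ptensDr u v v' : u ⊗ (v + v') = u ⊗ v + u ⊗ v'.
Proof.
rewrite /ptens -tens_piD; apply/tens_piP/asboolP; rewrite opprD addrA.
exact: TensNullDr.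
Qed.
Lemma ptensZl c u v : (c *: u) ⊗ v = c *: (u ⊗ v).
Proof. by rewrite /ptens -tens_piZ; apply/tens_piP/asboolP/TensNullZl. Qed.
Lemma ptensZr c u v : u ⊗ (c *: v) = c *: (u ⊗ v).
Proof. by rewrite /ptens -tens_piZ; apply/tens_piP/asboolP/TensNullZr. Qed.

Lemma ptens_bilinear : bilinear_for *:%R *:%R ptens.
Proof.
by split=> [v|u] c x y /=; rewrite ?ptensDl ?ptensZl ?ptensDr ?ptensZr.
Qed.

Lemma fgscaleU c (x : U * V) (d : k) :
  c *: << d *g x >> = << c * d *g x >> :> tens_free.
Proof. by apply/eqP/freeg_eqP => y; rewrite coeffZ !coeffU mulrA. Qed.

Lemma tensP (t : tens) : exists r : seq (U * V), t = \sum_(p <- r) p.1 ⊗ p.2.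
Proof.
have piS I (r : seq I) (F : I -> tens_free) :
    \pi_tens (\sum_(i <- r) F i) = \sum_(i <- r) \pi_tens (F i).
  apply: (big_morph (fun x : tens_free => \pi_tens x)) => [x y|].
    exact: tens_piD.
  by apply: (addIr (\pi_tens 0)); rewrite -tens_piD !add0r.
exists [seq (coeff z (repr t : tens_free) *: z.1, z.2) | z <- dom (repr t : tens_free)].
rewrite big_map -{1}[t]reprK -{1}[repr t]freeg_sumE piS.
apply: eq_bigr => -[u v] _ /=; rewrite ptensZl -tens_piZ fgscaleU.
by rewrite mulr1.
Qed.

Section Lift.
Variable (W : lmodType k).

Definition tens_lift (f : U -> V -> W) (t : tens) : W :=
  fglift (fun p => f p.1 p.2) (repr t : tens_free).

Variable f : U -> V -> W.
Hypothesis fB : bilinear_for *:%R *:%R f.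

Let g := fglift (fun p : U * V => f p.1 p.2) : tens_free -> W.

Let gB : {morph g : x y / x - y}. Proof. exact: lift_is_additive. Qed.
Let g0 : g 0 = 0. Proof. by rewrite -(subrr 0) gB subrr. Qed.
Let gN x : g (- x) = - g x. Proof. by rewrite -sub0r gB g0 sub0r. Qed.
Let gD x y : g (x + y) = g x + g y.
Proof. by rewrite -[y in LHS]opprK gB gN opprK. Qed.
Let gZ c x : g (c *: x) = c *: g x.
Proof.
have gS I (r : seq I) (F : I -> tens_free) :
    g (\sum_(i <- r) F i) = \sum_(i <- r) g (F i).
  exact: (big_morph g gD g0).
rewrite -[x]freeg_sumE scaler_sumr !gS scaler_sumr; apply: eq_bigr => z _.
by rewrite fgscaleU /g !liftU scalerA.
Qed.

Let g_null x : tens_null x -> g x = 0.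
Proof.
have [fl fr] := fB.
elim=> [u u' v|u v v'|c u v|c u v||c y z _ gy _ gz];
  rewrite ?gB ?gD ?gZ ?gy ?gz ?g0 ?scaler0 ?addr0 //
    /g !liftU !scale1r /=.
- by have /= := fl v 1 u u'; rewrite !scale1r => ->; rewrite -addrA -opprD subrr.
- by have /= := fr u 1 v v'; rewrite !scale1r => ->; rewrite -addrA -opprD subrr.
- have f0 : f 0 v = 0.
    by have /= := fl v (-1) 0 0; rewrite scaler0 addr0 scaleN1r addNr.
  by have /= := fl v c u 0; rewrite f0 !addr0 => ->; rewrite subrr.
- have f0 : f u 0 = 0.
    by have /= := fr u (-1) 0 0; rewrite scaler0 addr0 scaleN1r addNr.
  by have /= := fr u c v 0; rewrite f0 !addr0 => ->; rewrite subrr.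
Qed.

Let liftE x : tens_lift f (\pi_tens x) = g x.
Proof.
apply/eqP; rewrite -subr_eq0 -gB; apply/eqP/g_null/asboolP.
by apply/tens_piP; rewrite reprK.
Qed.

Lemma tens_liftE u v : tens_lift f (u ⊗ v) = f u v.
Proof. by rewrite liftE /g liftU scale1r. Qed.

Lemma tens_lift_linear : linear (tens_lift f).
Proof.
move=> c x y; rewrite -[x]reprK -[y]reprK -tens_piZ -tens_piD.
by rewrite !liftE gD gZ.
Qed.

End Lift.
End TensorProduct.

Arguments tens {k} (U V)%_type.
Notation "U ⊗ V" := (tens U V) : type_scope.
Notation "u ⊗ v" := (ptens u v) : ring_scope.

Lemma ptens_suml (k : comNzRingType) (V W : lmodType k) I (r : seq I)
    (f : I -> V) (w : W) :
  (\sum_(i <- r) f i) ⊗ w = \sum_(i <- r) f i ⊗ w.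
Proof.
apply: (big_morph (fun v => v ⊗ w)) => [x y|]; first exact: ptensDl.
by rewrite -(scale0r 0) ptensZl scale0r.
Qed.

Lemma ptens_sumr (k : comNzRingType) (V W : lmodType k) I (r : seq I)
    (f : I -> W) (v : V) :
  v ⊗ (\sum_(i <- r) f i) = \sum_(i <- r) v ⊗ f i.
Proof.
apply: (big_morph (fun w => v ⊗ w)) => [x y|]; first exact: ptensDr.
by rewrite -(scale0r 0) ptensZr scale0r.
Qed.

Lemma eq_tens_linear (k : comNzRingType) (U V W : lmodType k)
    (f g : {linear (U ⊗ V)%type -> W}) :
  (forall u v, f (u ⊗ v) = g (u ⊗ v)) -> f =1 g.
Proof.
move=> fg t; have [r ->] := tensP t.
by rewrite !linear_sum; apply: eq_bigr => p _; apply: fg.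
Qed.

Section TensorMaps.
Variable k : comNzRingType.

Section Map.
Variables (U U' V V' : lmodType k).
Variables (f : {linear U -> U'}) (g : {linear V -> V'}).

Lemma tens_map_bilinear : bilinear_for *:%R *:%R (fun u v => f u ⊗ g v).
Proof.
by split=> [v|u] c x y /=; rewrite linearP ?ptensDl ?ptensZl ?ptensDr ?ptensZr.
Qed.

Definition tens_map : U ⊗ V -> U' ⊗ V' := tens_lift (fun u v => f u ⊗ g v).

HB.instance Definition _ := GRing.isLinear.Build k (U ⊗ V)%type (U' ⊗ V')%type _ tens_map
  (tens_lift_linear tens_map_bilinear).

Lemma tens_mapE u v : tens_map (u ⊗ v) = f u ⊗ g v.
Proof. exact: tens_liftE tens_map_bilinear u v. Qed.
End Map.

Section Assoc.
Variables (U V W : lmodType k).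

Let assoc_in w (u : U) (v : V) : U ⊗ (V ⊗ W) := u ⊗ (v ⊗ w).
Let assoc_in_bilinear w : bilinear_for *:%R *:%R (assoc_in w).
Proof.
by split=> [v|u] c x y; rewrite /assoc_in /= ?(ptensDl, ptensDr, ptensZl, ptensZr).
Qed.
Let assoc_out (t : U ⊗ V) w := tens_lift (assoc_in w) t.
Let assoc_out_bilinear : bilinear_for *:%R *:%R assoc_out.
Proof.
split=> [w|t] c x y /=; first exact: tens_lift_linear.
have [r ->] := tensP t.
have S w : assoc_out (\sum_(p <- r) p.1 ⊗ p.2) w = \sum_(p <- r) assoc_in w p.1 p.2.
  pose h := GRing.isLinear.Build k _ _ _ _ (tens_lift_linear (assoc_in_bilinear w)).
  pose F : {linear (U ⊗ V)%type -> _} := HB.pack (tens_lift (assoc_in w)) h.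
  rewrite -[LHS]/(F _) linear_sum; apply: eq_bigr => p _.
  exact: tens_liftE.
rewrite !S scaler_sumr -big_split; apply: eq_bigr => p _ /=.
by rewrite /assoc_in !(ptensDr, ptensZr).
Qed.

Definition tens_assoc : (U ⊗ V) ⊗ W -> U ⊗ (V ⊗ W) :=
  tens_lift (fun t w => tens_lift (fun u v => u ⊗ (v ⊗ w)) t).

HB.instance Definition _ :=
  GRing.isLinear.Build k ((U ⊗ V) ⊗ W)%type (U ⊗ (V ⊗ W))%type _ tens_assoc
    (tens_lift_linear assoc_out_bilinear).

Lemma tens_assocE u v w : tens_assoc ((u ⊗ v) ⊗ w) = u ⊗ (v ⊗ w).
Proof.
rewrite [LHS](tens_liftE assoc_out_bilinear).
exact: (tens_liftE (assoc_in_bilinear w)).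
Qed.

Let associ_in (u : U) (v : V) w : (U ⊗ V) ⊗ W := (u ⊗ v) ⊗ w.
Let associ_in_bilinear u : bilinear_for *:%R *:%R (associ_in u).
Proof.
by split=> [w|v] c x y; rewrite /associ_in /= ?(ptensDl, ptensDr, ptensZl, ptensZr).
Qed.
Let associ_out u (t : V ⊗ W) := tens_lift (associ_in u) t.
Let associ_out_bilinear : bilinear_for *:%R *:%R associ_out.
Proof.
split=> [t|u] c x y /=; last exact: tens_lift_linear.
have [r ->] := tensP t.
have S u : associ_out u (\sum_(p <- r) p.1 ⊗ p.2) = \sum_(p <- r) associ_in u p.1 p.2.
  pose h := GRing.isLinear.Build k _ _ _ _ (tens_lift_linear (associ_in_bilinear u)).
  pose F : {linear (V ⊗ W)%type -> _} := HB.pack (tens_lift (associ_in u)) h.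
  rewrite -[LHS]/(F _) linear_sum; apply: eq_bigr => p _.
  exact: tens_liftE.
rewrite !S scaler_sumr -big_split; apply: eq_bigr => p _ /=.
by rewrite /associ_in !(ptensDl, ptensZl).
Qed.

Definition tens_associ : U ⊗ (V ⊗ W) -> (U ⊗ V) ⊗ W :=
  tens_lift (fun u t => tens_lift (fun v w => (u ⊗ v) ⊗ w) t).

HB.instance Definition _ :=
  GRing.isLinear.Build k (U ⊗ (V ⊗ W))%type ((U ⊗ V) ⊗ W)%type _ tens_associ
    (tens_lift_linear associ_out_bilinear).

Lemma tens_associE u v w : tens_associ (u ⊗ (v ⊗ w)) = (u ⊗ v) ⊗ w.
Proof.
rewrite [LHS](tens_liftE associ_out_bilinear).
exact: (tens_liftE (associ_in_bilinear u)).
Qed.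
End Assoc.

Section Mul.
Variable A : algType k.

Lemma mul_bilinear : bilinear_for *:%R *:%R (fun a b : A => a * b).
Proof.
by split=> [b|a] c x y /=; rewrite ?mulrDl ?mulrDr -?scalerAl -?scalerAr.
Qed.

Definition tens_mu : A ⊗ A -> A := tens_lift (fun a b => a * b).

HB.instance Definition _ := GRing.isLinear.Build k (A ⊗ A)%type A _ tens_mu
  (tens_lift_linear mul_bilinear).

Lemma tens_muE a b : tens_mu (a ⊗ b) = a * b.
Proof. exact: tens_liftE mul_bilinear a b. Qed.
End Mul.
End TensorMaps.

Arguments tens_assoc {k U V W}.
Arguments tens_associ {k U V W}.
Arguments tens_mu {k A}.

(* The last two axioms are equalities of maps on [(C ⊗ C) ⊗ A] and on          *)
(* [C ⊗ (A ⊗ A)]; the associativity isomorphisms are written out.             *)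
Record twisting_map (k : comNzRingType) (C A : algType k) := TwistingMap {
  twist :> {linear (C ⊗ A)%type -> (A ⊗ C)%type};
  twist1l : forall a, twist (1 ⊗ a) = a ⊗ 1;
  twist1r : forall c, twist (c ⊗ 1) = 1 ⊗ c;
  twistMl :
    twist \o tens_map tens_mu idfun =1
      tens_map idfun tens_mu \o tens_assoc \o tens_map twist idfun
        \o tens_associ \o tens_map idfun twist \o tens_assoc;
  twistMr :
    twist \o tens_map idfun tens_mu =1
      tens_map tens_mu idfun \o tens_associ \o tens_map idfun twist
        \o tens_assoc \o tens_map twist idfun \o tens_associ
}.

Definition twisted_tensor (k : comNzRingType) (C A : algType k)
  of twisting_map C A : Type := (A ⊗ C)%type.

Section TwistedTensorProduct.
Variables (k : comNzRingType) (C A : algType k) (s : twisting_map C A).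
Implicit Types (a b : A) (c d : C).

Local Notation twisted := (twisted_tensor s).
HB.instance Definition _ := GRing.Lmodule.on twisted.

Definition twisted_one : twisted := 1 ⊗ 1.

Definition twisted_mu : (A ⊗ C) ⊗ (A ⊗ C) -> A ⊗ C :=
  tens_map tens_mu tens_mu \o tens_associ \o tens_map idfun tens_assoc
    \o tens_map idfun (tens_map s idfun)
    \o tens_map idfun tens_associ \o tens_assoc.

HB.instance Definition _ := GRing.Linear.on twisted_mu.

Definition twisted_mul (x y : twisted) : twisted :=
  twisted_mu ((x : A ⊗ C) ⊗ (y : A ⊗ C)).

Lemma twisted_mulDl : left_distributive twisted_mul +%R.
Proof. by move=> x y z; rewrite /twisted_mul ptensDl linearD. Qed.
Lemma twisted_mulDr : right_distributive twisted_mul +%R.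
Proof. by move=> x y z; rewrite /twisted_mul ptensDr linearD. Qed.
Lemma twisted_mulZl e x y : twisted_mul (e *: x) y = e *: twisted_mul x y.
Proof. by rewrite /twisted_mul ptensZl linearZ. Qed.
Lemma twisted_mulZr e x y : twisted_mul x (e *: y) = e *: twisted_mul x y.
Proof. by rewrite /twisted_mul ptensZr linearZ. Qed.

Lemma twisted_mul_suml I (r : seq I) (F : I -> A ⊗ C) y :
  twisted_mul (\sum_(i <- r) F i) y = \sum_(i <- r) twisted_mul (F i) y.
Proof.
apply: (big_morph (twisted_mul^~ y)) => [x x'|]; first exact: twisted_mulDl.
by have := twisted_mulZl 0 0 y; rewrite !scale0r.
Qed.

Lemma twisted_mul_sumr I (r : seq I) (F : I -> A ⊗ C) x :
  twisted_mul x (\sum_(i <- r) F i) = \sum_(i <- r) twisted_mul x (F i).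
Proof.
apply: (big_morph (twisted_mul x)) => [y y'|]; first exact: twisted_mulDr.
by have := twisted_mulZr 0 x 0; rewrite !scale0r.
Qed.

Lemma twisted_mulE_sum a c b d I (r : seq I) (F : I -> A) (G : I -> C) :
    s (c ⊗ b) = \sum_(i <- r) F i ⊗ G i ->
  twisted_mul (a ⊗ c) (b ⊗ d) = \sum_(i <- r) (a * F i) ⊗ (G i * d).
Proof.
move=> sE; rewrite /twisted_mul /twisted_mu /=.
rewrite tens_assocE 2!tens_mapE /= tens_associE tens_mapE /= sE.
rewrite ptens_suml ptens_sumr !linear_sum; apply: eq_bigr => i _ /=.
rewrite tens_mapE /= tens_assocE tens_associE tens_mapE.
by rewrite /= !tens_muE.
Qed.

Let lr a d : A ⊗ C -> A ⊗ C := tens_map (a \*o idfun) (d \o* idfun).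
Let lrE a d b c : lr a d (b ⊗ c) = (a * b) ⊗ (c * d).
Proof. exact: tens_mapE. Qed.
Let lr_sum a d I (r : seq I) (F : I -> A ⊗ C) :
  lr a d (\sum_(i <- r) F i) = \sum_(i <- r) lr a d (F i).
Proof. by rewrite /lr linear_sum. Qed.

Let rp (t : A ⊗ C) : seq (A * C) := sval (cid (tensP t)).
Let rpE t : t = \sum_(p <- rp t) p.1 ⊗ p.2.
Proof. exact: svalP (cid (tensP t)). Qed.

Lemma twisted_mulE a c b d :
  twisted_mul (a ⊗ c) (b ⊗ d) = lr a d (s (c ⊗ b)).
Proof.
rewrite (twisted_mulE_sum _ _ (rpE (s (c ⊗ b)))) [in RHS](rpE (s (c ⊗ b))).
by rewrite lr_sum; apply: eq_bigr => p _; rewrite lrE.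
Qed.

Let twistMlE c d e : s ((c * d) ⊗ e) =
  \sum_(q <- rp (s (d ⊗ e))) \sum_(p <- rp (s (c ⊗ q.1))) p.1 ⊗ (p.2 * q.2).
Proof.
have := twistMl s ((c ⊗ d) ⊗ e).
rewrite /= tens_mapE /= tens_muE tens_assocE tens_mapE /= => ->.
rewrite [in LHS](rpE (s (d ⊗ e))) ptens_sumr.
rewrite (linear_sum tens_associ) (linear_sum (tens_map s idfun)).
rewrite (linear_sum tens_assoc) (linear_sum (tens_map idfun tens_mu)).
apply: eq_bigr => q _; rewrite /= tens_associE tens_mapE /=.
rewrite [in LHS](rpE (s (c ⊗ q.1))) ptens_suml.
rewrite (linear_sum tens_assoc) (linear_sum (tens_map idfun tens_mu)).
by apply: eq_bigr => p _; rewrite /= tens_assocE tens_mapE /= tens_muE.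
Qed.

Let twistMrE c a b : s (c ⊗ (a * b)) =
  \sum_(p <- rp (s (c ⊗ a))) \sum_(q <- rp (s (p.2 ⊗ b))) (p.1 * q.1) ⊗ q.2.
Proof.
have := twistMr s (c ⊗ (a ⊗ b)).
rewrite /= tens_mapE /= tens_muE tens_associE tens_mapE /= => ->.
rewrite [in LHS](rpE (s (c ⊗ a))) ptens_suml.
rewrite (linear_sum tens_assoc) (linear_sum (tens_map idfun s)).
rewrite (linear_sum tens_associ) (linear_sum (tens_map tens_mu idfun)).
apply: eq_bigr => p _; rewrite /= tens_assocE tens_mapE /=.
rewrite [in LHS](rpE (s (p.2 ⊗ b))) ptens_sumr.
rewrite (linear_sum tens_associ) (linear_sum (tens_map tens_mu idfun)).
by apply: eq_bigr => q _; rewrite /= tens_associE tens_mapE /= tens_muE.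
Qed.

Fact twisted_mul1 : left_id twisted_one twisted_mul.
Proof.
move=> x; rewrite [x]rpE twisted_mul_sumr; apply: eq_bigr => p _.
by rewrite [LHS]twisted_mulE twist1l lrE !mul1r.
Qed.

Fact twisted_mulr1 : right_id twisted_one twisted_mul.
Proof.
move=> x; rewrite [x]rpE twisted_mul_suml; apply: eq_bigr => p _.
by rewrite [LHS]twisted_mulE twist1r lrE !mulr1.
Qed.

Fact twisted_mulA : associative twisted_mul.
Proof.
move=> x y z; rewrite [x]rpE !twisted_mul_suml; apply: eq_bigr => -[a c] _.
rewrite [y]rpE twisted_mul_suml !twisted_mul_sumr twisted_mul_suml.
apply: eq_bigr => -[b d] _ /=.
rewrite [z]rpE !twisted_mul_sumr; apply: eq_bigr => -[e f] _ /=.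
rewrite !twisted_mulE (rpE (s (d ⊗ e))) (rpE (s (c ⊗ b))) !lr_sum.
rewrite twisted_mul_sumr twisted_mul_suml.
transitivity (\sum_(q <- rp (s (d ⊗ e))) \sum_(p <- rp (s (c ⊗ b)))
  \sum_(r <- rp (s (p.2 ⊗ q.1))) (a * p.1 * r.1) ⊗ (r.2 * q.2 * f)).
  apply: eq_bigr => q _; rewrite lrE twisted_mulE twistMrE lr_sum.
  apply: eq_bigr => p _; rewrite lr_sum; apply: eq_bigr => r _.
  by rewrite lrE !mulrA.
rewrite exchange_big; apply: eq_bigr => p _ /=; rewrite lrE twisted_mulE.
rewrite twistMlE lr_sum; apply: eq_bigr => q _; rewrite lr_sum.
by apply: eq_bigr => r _; rewrite lrE.
Qed.

HB.instance Definition _ := GRing.Zmodule_isPzRing.Build twisted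
  twisted_mulA twisted_mul1 twisted_mulr1 twisted_mulDl twisted_mulDr.

Definition twisted_inl (a : A) : twisted := a ⊗ 1.
Definition twisted_inr (c : C) : twisted := 1 ⊗ c.

Fact twisted_inl_linear : linear twisted_inl.
Proof. by move=> e a b; rewrite /twisted_inl ptensDl ptensZl. Qed.
Fact twisted_inl_monoid_morphism : monoid_morphism twisted_inl.
Proof.
split=> // a b; rewrite /twisted_inl.
by rewrite [RHS]twisted_mulE twist1l lrE mulr1.
Qed.
HB.instance Definition _ :=
  GRing.isLinear.Build k A twisted _ twisted_inl twisted_inl_linear.
HB.instance Definition _ := GRing.isMonoidMorphism.Build A twisted twisted_inl
  twisted_inl_monoid_morphism.

Fact twisted_inr_linear : linear twisted_inr.
Proof. by move=> e c d; rewrite /twisted_inr ptensDr ptensZr. Qed.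
Fact twisted_inr_monoid_morphism : monoid_morphism twisted_inr.
Proof.
split=> // c d; rewrite /twisted_inr.
by rewrite [RHS]twisted_mulE twist1r lrE mul1r.
Qed.
HB.instance Definition _ :=
  GRing.isLinear.Build k C twisted _ twisted_inr twisted_inr_linear.
HB.instance Definition _ := GRing.isMonoidMorphism.Build C twisted twisted_inr
  twisted_inr_monoid_morphism.

Lemma twisted_inlr a c : twisted_inl a * twisted_inr c = a ⊗ c.
Proof. by rewrite [LHS]twisted_mulE twist1l lrE mulr1 mul1r. Qed.

End TwistedTensorProduct.


Arguments twisted_tensor {k} (C A)%_type s.
Notation "A ⊗[ s ] C" := (twisted_tensor C A s)
  (at level 39, s at level 200, left associativity,
   format "A  ⊗[ s ]  C") : type_scope.

(* [{poly %/ h}] falls back to [h = 'X] when [h] is not monic of size > 1, so  *)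
(* this is k[y]/<y^n> only for [0 < n]; [y] is then ['qX].                     *)
Notation truncpoly k n := {poly %/ ('X^n : {poly k})}.

Section TruncatedPolynomials.
Variables (k : comNzRingType) (n : nat).
Local Notation C := (truncpoly k n).
Local Notation y := ('qX : C).

Lemma coef_qX (n_gt0 : (0 < n)%N) (i j : nat) :
  (i < n)%N -> (y ^+ i : {poly k})`_j = (j == i)%:R.
Proof.
move=> lt_in; rewrite -(rmorphXn (in_qpoly ('X^n : {poly k}))) in_qpoly_small.
  by rewrite coefXn.
by rewrite mk_monic_Xn !size_polyXn prednK.
Qed.

Lemma truncpoly_sum (n_gt0 : (0 < n)%N) (c : C) :
  c = \sum_(j < n) (c : {poly k})`_j *: y ^+ j.
Proof.
apply: val_inj; apply/polyP => i /=.
rewrite raddf_sum coef_sum /=.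
have [lt_in|le_ni] := ltnP i n.
  rewrite (bigD1 (Ordinal lt_in)) //= big1 => [|j neq_ji].
    by rewrite addr0 coefZ coef_qX // eqxx mulr1.
  rewrite coefZ coef_qX // [i == j]eq_sym.
  by rewrite (negPf (_ : (j != i :> nat)%N)) ?mulr0.
rewrite big1 => [|j _].
  apply: nth_default; apply: leq_trans le_ni; rewrite -ltnS.
  have szE : size (mk_monic ('X^n : {poly k})) = n.+1.
    by rewrite mk_monic_Xn size_polyXn prednK.
  by rewrite -[X in (_ < X)%N]szE size_mk_monic.
rewrite coefZ coef_qX // [i == j]eq_sym.
by rewrite ltn_eqF ?mulr0 // (leq_trans _ le_ni).
Qed.

Section Coord.
Variables (A : algType k) (j : nat).

Lemma tcoord_bilinear :
  bilinear_for *:%R *:%R (fun (a : A) (c : C) => (c : {poly k})`_j *: a).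
Proof.
split=> [c|a] e x x' /=; first by rewrite scalerDr !scalerA mulrC.
by rewrite coefD coefZ scalerDl scalerA.
Qed.

(* The coefficient of [y ^+ j] in an element of [A ⊗ C]. *)
Definition tcoord : A ⊗ C -> A := tens_lift (fun (a : A) (c : C) => (c : {poly k})`_j *: a).

HB.instance Definition _ := GRing.isLinear.Build k (A ⊗ C)%type A _ tcoord
  (tens_lift_linear tcoord_bilinear).

Lemma tcoordE a c : tcoord (a ⊗ c) = (c : {poly k})`_j *: a.
Proof. exact: tens_liftE tcoord_bilinear a c. Qed.
End Coord.

Variables (A : algType k) (s : twisting_map C A).

Lemma twisted_one_neq0 : (1 : A ⊗[s] C) != 0.
Proof.
apply/eqP => /(congr1 (tcoord 0)); rewrite linear0 tcoordE coefC eqxx scale1r.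
by apply/eqP; rewrite oner_eq0.
Qed.

Fact twisted_scalerAl e (x y : A ⊗[s] C) : e *: (x * y) = (e *: x) * y.
Proof. by rewrite [RHS]twisted_mulZl. Qed.
Fact twisted_scalerAr e (x y : A ⊗[s] C) : e *: (x * y) = x * (e *: y).
Proof. by rewrite [RHS]twisted_mulZr. Qed.

HB.instance Definition _ := GRing.PzSemiRing_isNonZero.Build (A ⊗[s] C)%type
  twisted_one_neq0.
HB.instance Definition _ := GRing.Lmodule_isLalgebra.Build k (A ⊗[s] C)%type
  twisted_scalerAl.
HB.instance Definition _ := GRing.Lalgebra_isAlgebra.Build k (A ⊗[s] C)%type
  twisted_scalerAr.

(* Characterized by [gammaE] and [gamma_uniq] below. *)
Definition gamma (r j : 'I_n) (a : A) : A := tcoord j (s ((y ^+ r) ⊗ a)).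

Lemma tens_truncpolyE (n_gt0 : (0 < n)%N) (t : A ⊗ C) :
  t = \sum_(j < n) tcoord j t ⊗ (y ^+ j).
Proof.
have [r ->] := tensP t; under [RHS]eq_bigr do rewrite linear_sum /=.
under [RHS]eq_bigr do rewrite ptens_suml.
rewrite exchange_big; apply: eq_bigr => -[a c] _ /=.
rewrite {1}[c]truncpoly_sum // ptens_sumr; apply: eq_bigr => j _.
by rewrite tcoordE ptensZl ptensZr.
Qed.

Lemma gammaE (n_gt0 : (0 < n)%N) (r : 'I_n) a :
  s ((y ^+ r) ⊗ a) = \sum_(j < n) gamma r j a ⊗ (y ^+ j).
Proof. exact: tens_truncpolyE. Qed.

Lemma gamma_uniq (n_gt0 : (0 < n)%N) (r : 'I_n) a (g : 'I_n -> A) :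
  s ((y ^+ r) ⊗ a) = \sum_(j < n) g j ⊗ (y ^+ j) -> forall j, g j = gamma r j a.
Proof.
move=> sE j; rewrite /gamma sE linear_sum (bigD1 j) //= big1 => [|i neq_ij].
  by rewrite addr0 tcoordE coef_qX // eqxx scale1r.
rewrite tcoordE coef_qX // [j == i :> nat]eq_sym.
by rewrite (negPf (neq_ij : (i != j :> nat)%N)) scale0r.
Qed.

Definition gamma_mx (a : A) : 'M[A]_n := \matrix_(i, j) gamma i j a.

End TruncatedPolynomials.

Definition jordan0 (R : pzRingType) n : 'M[R]_n :=
  \matrix_(i, j) (j == i.+1 :> nat)%:R.

(* Main.v *)
From HB Require Import structures.
Require Import Defs.
From mathcomp Require Import all_boot all_algebra.

(** Write [B] for the twisted tensor product [A ⊗[s] C].  As a left [A]-module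
    it is free on [1, y, ..., y ^+ n.-1], and right multiplication by an element
    [x] of [B] is left [A]-linear; [phi x] is the matrix of that endomorphism,
    its [i]-th row holding the coordinates of [y ^+ i * x].  With coordinates
    written as rows, composing right multiplications in the order in which they
    act is multiplying matrices in the same order, so [phi] is a morphism and
    not an anti-morphism: it is the right regular representation of [B]
    ([right_mul_mx_monoid_morphism]).

    For [x = a] in [A] the product [y ^+ i * a] is [s (y ^+ i ⊗ a)], whose
    coordinates are the [gamma i j a]; for [x = y] multiplication shifts the
    basis and kills its last vector because [y ^+ n = 0], which is the Jordan
    matrix.  The representation is faithful since the first row of [phi x] lists
    the coordinates of [1 * x = x].  Finally [B] is generated by [A] and [y], so
    the two values determine [phi]. *)

Set Implicit Arguments.
Unset Strict Implicit.
Unset Printing Implicit Defensive.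

Import GRing.Theory.
Local Open Scope ring_scope.

Section RightRegularRepresentation.
Variables (k : comNzRingType) (n : nat) (n_gt0 : (0 < n)%N).
Variables (A : algType k) (s : twisting_map (truncpoly k n) A).
Local Notation C := (truncpoly k n).
Local Notation y := ('qX : C).
Local Notation inA := (twisted_inl s).
Local Notation inC := (twisted_inr s).

Lemma qXn_eq0 : y ^+ n = 0.
Proof.
apply: val_inj; rewrite -(rmorphXn (in_qpoly ('X^n : {poly k}))) /=.
by rewrite mk_monic_Xn prednK // Pdiv.RingMonic.rmodpp // monicXn.
Qed.

(** The exponent [i <= n] rather than [i < n] covers the product of [y] with the
    last basis vector, whose coordinates all vanish. *)
Lemma coef_qX_le (i j : nat) :
  (i <= n)%N -> (j < n)%N -> (y ^+ i : {poly k})`_j = (j == i)%:R.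
Proof.
rewrite leq_eqVlt => /predU1P[-> lt_jn|lt_in _]; last exact: coef_qX.
by rewrite qXn_eq0 coef0 ltn_eqF.
Qed.

Lemma inC_qXn i : inC (y ^+ i) = inC y ^+ i.
Proof. exact: rmorphXn. Qed.

Lemma twisted_mul_inC_inA c a : inC c * inA a = s (c ⊗ a).
Proof.
have [r sE] := tensP (s (c ⊗ a)).
rewrite [LHS](twisted_mulE_sum _ _ sE) sE; apply: eq_bigr => p _.
by rewrite mul1r mulr1.
Qed.

(** Left [A]-linearity of the coordinates: left multiplication by an element of
    [A] does not involve the twist. *)
Lemma tcoord_mull j a (x : A ⊗[s] C) : tcoord j (inA a * x) = a * tcoord j x.
Proof.
have [r ->] := tensP x; rewrite [in RHS]linear_sum.
rewrite (mulr_sumr r xpredT _ (inA a)) linear_sum mulr_sumr.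
apply: eq_bigr => -[b c] _ /=.
rewrite -[in LHS]twisted_inlr mulrA -rmorphM [X in tcoord j X]twisted_inlr.
by rewrite !tcoordE -scalerAr.
Qed.

Lemma twisted_basisE (x : A ⊗[s] C) :
  x = \sum_(j < n) inA (tcoord j x) * inC y ^+ j.
Proof.
rewrite [LHS](tens_truncpolyE n_gt0); apply: eq_bigr => j _.
by rewrite -inC_qXn twisted_inlr.
Qed.

Definition right_mul_mx (x : A ⊗[s] C) : 'M[A]_n :=
  \matrix_(i, j) tcoord j (inC y ^+ i * x).

Fact right_mul_mx_linear : linear_for (GRing.in_alg A \; *:%R) right_mul_mx.
Proof.
move=> e x x'; apply/matrixP => i j; rewrite !mxE mulrDr -scalerAr /=.
by rewrite linearP mulr_algl.
Qed.

(** Expanding [y ^+ i * x] in the basis and pulling the coefficients out by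
    left [A]-linearity turns the coordinates of [y ^+ i * x * x'] into the
    [i]-th row of the matrix product. *)
Fact right_mul_mx_monoid_morphism : monoid_morphism right_mul_mx.
Proof.
split=> [|x x']; apply/matrixP => i j; rewrite !mxE.
  rewrite mulr1 -inC_qXn tcoordE coef_qX // [i == j]eq_sym.
  by rewrite scaler_nat.
rewrite mulrA [_ * x in LHS]twisted_basisE mulr_suml linear_sum.
by apply: eq_bigr => l _; rewrite !mxE -mulrA [LHS]tcoord_mull.
Qed.

Lemma right_mul_mx_inA a : right_mul_mx (inA a) = gamma_mx s a.
Proof.
by apply/matrixP => i j; rewrite !mxE -inC_qXn twisted_mul_inC_inA.
Qed.

Lemma right_mul_mx_inC_qX : right_mul_mx (inC y) = jordan0 A n.
Proof.
apply/matrixP => i j; rewrite !mxE -exprSr -inC_qXn tcoordE.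
by rewrite coef_qX_le // scaler_nat.
Qed.

Lemma right_mul_mx_inj : injective right_mul_mx.
Proof.
move=> x x' /matrixP eq_xx'; rewrite [x]twisted_basisE [x']twisted_basisE.
apply: eq_bigr => j _; congr (inA _ * _).
(* Row 0, since [y ^+ 0 = 1]. *)
by have := eq_xx' (Ordinal n_gt0) j; rewrite !mxE expr0 !mul1r.
Qed.

(** The expansion in the basis exhibits [A] and [y] as generators of [B]. *)
Lemma twisted_rmorph_eq (S : pzRingType) (f g : {rmorphism A ⊗[s] C -> S}) :
  (forall a, f (inA a) = g (inA a)) -> f (inC y) = g (inC y) -> f =1 g.
Proof.
move=> fgA fgy x; rewrite [x]twisted_basisE !rmorph_sum.
by apply: eq_bigr => j _; rewrite !rmorphM !rmorphXn fgA fgy.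
Qed.

End RightRegularRepresentation.

Theorem theorem1p10 (k : comNzRingType) (n : nat) (n_gt0 : (0 < n)%N)
    (A : algType k) (s : twisting_map (truncpoly k n) A) :
  exists phi : {lrmorphism A ⊗[s] (truncpoly k n) -> 'M[A]_n
                 | GRing.in_alg A \; *:%R},
    [/\ forall a : A, phi (twisted_inl s a) = gamma_mx s a,
        phi (twisted_inr s 'qX) = jordan0 A n,
        injective phi
      & forall psi : {lrmorphism A ⊗[s] (truncpoly k n) -> 'M[A]_n
                       | GRing.in_alg A \; *:%R},
          (forall a : A, psi (twisted_inl s a) = gamma_mx s a) ->
          psi (twisted_inr s 'qX) = jordan0 A n ->
          psi =1 phi].
Proof.
pose L := GRing.isLinear.Build k (A ⊗[s] (truncpoly k n))%type 'M[A]_n _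
  (@right_mul_mx k n A s) (@right_mul_mx_linear k n A s).
pose M := GRing.isMonoidMorphism.Build (A ⊗[s] (truncpoly k n))%type 'M[A]_n
  (@right_mul_mx k n A s) (right_mul_mx_monoid_morphism n_gt0 s).
pose phi : {lrmorphism A ⊗[s] (truncpoly k n) -> 'M[A]_n
    | GRing.in_alg A \; *:%R} := HB.pack (@right_mul_mx k n A s) L M.
exists phi; split=> [a|||psi psiA psiy].
- exact: right_mul_mx_inA.
- exact: right_mul_mx_inC_qX.
- exact: right_mul_mx_inj.
- apply: (twisted_rmorph_eq n_gt0) => [a|].
    exact: etrans (psiA a) (esym (right_mul_mx_inA s a)).
  exact: etrans psiy (esym (right_mul_mx_inC_qX n_gt0 s)).
Qed.
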